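(* Let $\Omega$ be a starlike domain in $\mathbb{R}^n$ with center $0$. For any Clifford-valued function $f(\underline{x})$ in $\Omega$, the following relation holds for each $s\in\mathbb{N}$: $$D'\left((x')^sf(\underline{x})\right)=-2(x')^{s-1}U_s'f(\underline{x})+(-1)^s(x')^sD'f(\underline{x}),$$ where $$U_s'=\begin{cases}k\,\mathbf{id},&\text{if } s=2k,\\ E'+\left(\frac n2+k\right)\mathbf{id},&\text{if } s=2k+1.\end{cases}$$
   Context: Let $n\ge 1$ and let $\mathbb{R}[\underline{x}]$ be the ring of real polynomials in $\underline{x}=(x_1,\ldots,x_n)$. A linear operator on $\mathbb{R}[\underline{x}]$ is shift-invariant if it commutes with all translations $f(\underline{x})\mapsto f(\underline{x}+\underline{y})$. A multivariate delta operator is a tuple $(O_{x_1},\ldots,O_{x_n})$ of shift-invariant linear operators on $\mathbb{R}[\underline{x}]$ for which there is a constant $c\ne0$ with $O_{x_j}(x_k)=c\,\delta_{jk}$ for all $j,k$. Fix such a tuple, together with linear operators $x_1',\ldots,x_n'$ on $\mathbb{R}[\underline{x}]$ satisfying the Weyl--Heisenberg relations $[O_{x_j},O_{x_k}]=0=[x_j',x_k']$, $[O_{x_j},x_k']=\delta_{jk}\mathbf{id}$, where $[a,b]=ab-ba$. Let $C\ell_{0,n}$ be the real Clifford algebra generated by $\mathbf{e}_1,\ldots,\mathbf{e}_n$ with $\mathbf{e}_j\mathbf{e}_k+\mathbf{e}_k\mathbf{e}_j=-2\delta_{jk}$, and $\mathcal{P}=\mathbb{R}[\underline{x}]\otimes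 C\ell_{0,n}$. The operators $O_{x_j},x_j'$ act on the polynomial factor and $\mathbf{e}_j$ acts by left multiplication. Put $D'=\sum_j\mathbf{e}_jO_{x_j}$, $x'=\sum_j\mathbf{e}_jx_j'$, $E'=\sum_jx_j'O_{x_j}$, linear operators on $\mathcal{P}$. Clifford-valued functions in $\Omega$ are elements of $\mathcal{P}$ regarded as functions $\Omega\to C\ell_{0,n}$. A domain $\Omega$ is starlike with center $0$ if $t\underline{x}\in\Omega$ for all $\underline{x}\in\Omega$, $0\le t\le1$. $\mathbb{N}=\{1,2,\ldots\}$. *)

(* Defs.v *)
From HB Require Import structures.
From mathcomp Require Import all_boot all_order all_algebra.
From mathcomp Require Import classical_sets reals topology.
From mathcomp Require Import mpoly ring.

Set Implicit Arguments.
Unset Strict Implicit.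
Unset Printing Implicit Defensive.

Import Order.TTheory GRing.Theory Num.Theory.
Import numFieldTopology.Exports.

Local Open Scope ring_scope.

Definition symdiff (n : nat) (A B : {set 'I_n}) : {set 'I_n} :=
  (A :\: B) :|: (B :\: A).

(* [clifford n K] is the Clifford algebra over K on n anticommuting generators
   of square -1.  An element is the family of its coordinates on the basis
   e_A = e_{i_1} ... e_{i_k}, where A = {i_1 < ... < i_k} (see [cl_basisE]). *)
Definition clifford (n : nat) (K : Type) : Type := {ffun {set 'I_n} -> K}.

HB.instance Definition _ (n : nat) (K : comNzRingType) :=
  GRing.Lmodule.copy (clifford n K) {ffun {set 'I_n} -> K^o}.

Section Clifford.
Variables (n : nat) (K : comNzRingType).
Implicit Types (A B C : {set 'I_n}) (u v w : clifford n K).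

(* e_A * e_B = cl_sign A B * e_(A symdiff B): reordering the product costs one
   sign for each pair j < i with i in A and j in B, and every common index i
   contributes e_i ^ 2 = -1. *)
Definition cl_sign A B : K :=
  (-1) ^+ #|[set p : 'I_n * 'I_n |
              [&& p.1 \in A, p.2 \in B & (p.2 <= p.1)%N]]|.

Definition cl_basis A : clifford n K := [ffun B => (A == B)%:R].

Definition cl_one : clifford n K := cl_basis finset.set0.

Definition cl_mul u v : clifford n K :=
  [ffun C => \sum_A cl_sign A (symdiff A C) * (u A * v (symdiff A C))].

Lemma in_symdiff A B i : (i \in symdiff A B) = (i \in A) (+) (i \in B).
Proof. by rewrite !inE; case: (i \in A); case: (i \in B). Qed.

Lemma symdiffA A B C : symdiff A (symdiff B C) = symdiff (symdiff A B) C.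
Proof. by apply/setP=> i; rewrite !in_symdiff addbA. Qed.

Lemma symdiffC A B : symdiff A B = symdiff B A.
Proof. by apply/setP=> i; rewrite !in_symdiff addbC. Qed.

Lemma symdiff0 A : symdiff A finset.set0 = A.
Proof. by apply/setP=> i; rewrite in_symdiff inE addbF. Qed.

Lemma symdiff0l A : symdiff finset.set0 A = A.
Proof. by rewrite symdiffC symdiff0. Qed.

Lemma symdiffK A B : symdiff A (symdiff A B) = B.
Proof. by apply/setP=> i; rewrite !in_symdiff addKb. Qed.

Lemma symdiffAA A : symdiff A A = finset.set0.
Proof. by apply/setP=> i; rewrite in_symdiff inE addbb. Qed.

Lemma symdiff_eq A B C : (A == symdiff B C) = (C == symdiff B A).
Proof. by apply/eqP/eqP => ->; rewrite symdiffK. Qed.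

Lemma cl_signE A B :
  cl_sign A B =
  \prod_(p : 'I_n * 'I_n) (-1) ^+ [&& p.1 \in A, p.2 \in B & (p.2 <= p.1)%N].
Proof.
rewrite /cl_sign -sum1dep_card big_mkcond prodrXr; congr (_ ^+ _).
Qed.

Lemma cl_signDl A B C :
  cl_sign (symdiff A B) C = cl_sign A C * cl_sign B C.
Proof.
rewrite !cl_signE -big_split; apply: eq_bigr => p _ /=.
rewrite in_symdiff -signr_addb; congr (_ ^+ nat_of_bool _).
by case: (_ \in A); case: (_ \in B); case: (_ \in C); case: leqP.
Qed.

Lemma cl_signDr A B C :
  cl_sign A (symdiff B C) = cl_sign A B * cl_sign A C.
Proof.
rewrite !cl_signE -big_split; apply: eq_bigr => p _ /=.
rewrite in_symdiff -signr_addb; congr (_ ^+ nat_of_bool _).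
by case: (_ \in A); case: (_ \in B); case: (_ \in C); case: leqP.
Qed.

Lemma cl_sign0l A : cl_sign finset.set0 A = 1.
Proof. by rewrite cl_signE big1 // => p _; rewrite inE. Qed.

Lemma cl_sign0r A : cl_sign A finset.set0 = 1.
Proof. by rewrite cl_signE big1 // => p _; rewrite inE andbF. Qed.

Lemma cl_mulA : associative cl_mul.
Proof.
move=> u v w; apply/ffunP=> C; rewrite !ffunE.
transitivity (\sum_A \sum_B cl_sign A (symdiff A C) * (u A *
   (cl_sign B (symdiff B (symdiff A C)) *
    (v B * w (symdiff B (symdiff A C)))))).
  by apply: eq_bigr => A _; rewrite ffunE !mulr_sumr.
transitivity (\sum_D \sum_A cl_sign D (symdiff D C) *
   (cl_sign A (symdiff A D) * (u A * v (symdiff A D)) * w (symdiff D C))).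
  rewrite exchange_big [RHS]exchange_big /=.
  rewrite exchange_big; apply: eq_bigr => A _ /=.
  rewrite [RHS](reindex_inj (h := symdiff A)) /=; last first.
    by move=> X Y /(congr1 (symdiff A)); rewrite !symdiffK.
  apply: eq_bigr => B _; rewrite symdiffK.
  have -> : symdiff (symdiff A B) C = symdiff B (symdiff A C).
    by rewrite (symdiffC A B) symdiffA.
  rewrite cl_signDl ![cl_sign _ (symdiff B _)]cl_signDr.
  have sq : cl_sign A B * cl_sign A B = 1.
    by rewrite -cl_signDr symdiffAA cl_sign0r.
  rewrite -[LHS]mul1r -[in LHS]sq.
  move: (cl_sign A B) (cl_sign A _) (cl_sign B B) (cl_sign B _) => a b c d.
  by ring.
by apply: eq_bigr => D _; rewrite ffunE mulr_suml mulr_sumr.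
Qed.

Lemma cl_mul1l : left_id cl_one cl_mul.
Proof.
move=> u; apply/ffunP=> C; rewrite ffunE (bigD1 finset.set0) //= big1 ?addr0.
  by rewrite symdiff0l cl_sign0l ffunE eqxx !mul1r.
by move=> A; rewrite eq_sym ffunE => /negbTE->; rewrite mul0r mulr0.
Qed.

Lemma cl_mul1r : right_id cl_one cl_mul.
Proof.
move=> u; apply/ffunP=> C; rewrite ffunE (bigD1 C) //= big1 ?addr0.
  by rewrite symdiffAA cl_sign0r ffunE eqxx mulr1 mul1r.
move=> A neAC; rewrite [cl_one _]ffunE symdiff_eq symdiff0 eq_sym.
by rewrite (negbTE neAC) !mulr0.
Qed.

Lemma cl_mulDl : left_distributive cl_mul +%R.
Proof.
move=> u v w; apply/ffunP=> C; rewrite !ffunE -big_split.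
by apply: eq_bigr => A _; rewrite ffunE mulrDl mulrDr.
Qed.

Lemma cl_mulDr : right_distributive cl_mul +%R.
Proof.
move=> u v w; apply/ffunP=> C; rewrite !ffunE -big_split.
by apply: eq_bigr => A _; rewrite ffunE !mulrDr.
Qed.

Lemma cl_one_neq0 : cl_one != 0.
Proof.
apply/eqP => /ffunP/(_ finset.set0); rewrite !ffunE eqxx => /eqP.
by rewrite oner_eq0.
Qed.

HB.instance Definition _ := GRing.Zmodule_isNzRing.Build (clifford n K)
  cl_mulA cl_mul1l cl_mul1r cl_mulDl cl_mulDr cl_one_neq0.

Lemma cl_scaleAl (a : K) u v : a *: (u * v) = (a *: u) * v.
Proof.
apply/ffunP=> C; rewrite !ffunE scaler_sumr; apply: eq_bigr => A _.
by rewrite ffunE /GRing.scale /= mulrCA !mulrA.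
Qed.

HB.instance Definition _ :=
  GRing.Lmodule_isLalgebra.Build K (clifford n K) cl_scaleAl.

Lemma cl_scaleAr (a : K) u v : a *: (u * v) = u * (a *: v).
Proof.
apply/ffunP=> C; rewrite !ffunE scaler_sumr; apply: eq_bigr => A _.
by rewrite ffunE /GRing.scale /=; ring.
Qed.

HB.instance Definition _ :=
  GRing.Lalgebra_isAlgebra.Build K (clifford n K) cl_scaleAr.

Definition cl_gen (i : 'I_n) : clifford n K := cl_basis [set i].

Lemma cl_basisM A B :
  cl_basis A * cl_basis B = cl_sign A B *: cl_basis (symdiff A B).
Proof.
apply/ffunP=> C; rewrite !ffunE (bigD1 A) //= big1 ?addr0; last first.
  by move=> D neDA; rewrite ffunE eq_sym (negbTE neDA) mul0r mulr0.
rewrite !ffunE eqxx mul1r symdiff_eq eq_sym /GRing.scale /=.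
by case: eqP => [<-|]; rewrite ?symdiffK ?mulr0 // ?mulr1.
Qed.

Lemma cl_genM (i j : 'I_n) :
  cl_gen i * cl_gen j + cl_gen j * cl_gen i = - (2 * (i == j)%:R).
Proof.
have sgn1 (k l : 'I_n) : cl_sign [set k] [set l] = (-1) ^+ (l <= k)%N.
  rewrite cl_signE (bigD1 (k, l)) //= !inE !eqxx /= big1 ?mulr1 // => -[a b].
  by rewrite !inE xpair_eqE; case: eqP => //= _; case: eqP.
rewrite !cl_basisM !sgn1 (symdiffC [set j]).
case: (ltngtP i j) => [lt_ij|lt_ji|/val_inj eq_ij].
- rewrite expr0 expr1 -scalerDl addrN scale0r.
  by rewrite (_ : (i == j) = false) ?mulr0 ?oppr0 //; apply/eqP => e;
     rewrite e ltnn in lt_ij.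
- rewrite expr0 expr1 -scalerDl addNr scale0r.
  by rewrite (_ : (i == j) = false) ?mulr0 ?oppr0 //; apply/eqP => e;
     rewrite e ltnn in lt_ji.
by rewrite eq_ij eqxx symdiffAA expr1 scaleN1r mulr1 -opprD -mulr2n.
Qed.

Lemma cl_basisE A : cl_basis A = \prod_(i <- enum A) cl_gen i.
Proof.
have prodE (s : seq 'I_n) : sorted ltn (map val s) ->
    \prod_(i <- s) cl_gen i = cl_basis [set i in s].
  elim: s => [|i s IHs] /=.
    by move=> _; rewrite big_nil; congr cl_basis; apply/setP => i; rewrite !inE.
  move=> ps; rewrite big_cons IHs ?(path_sorted ps) // cl_basisM.
  have lt_is k : k \in s -> (i < k)%N.
    move=> ks; move: ps; rewrite (path_sortedE ltn_trans) => /andP[/allP h _].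
    by apply: h; apply: map_f.
  rewrite cl_signE big1 ?scale1r; last first.
    move=> [a b] _; rewrite !inE /=; case: eqP => //= ->.
    by case bs: (b \in s); rewrite //= leqNgt lt_is.
  congr cl_basis; apply/setP => k; rewrite in_symdiff !inE.
  by case: eqP => //= ->; apply/negP => /lt_is; rewrite ltnn.
rewrite prodE; last first.
  rewrite sorted_map {1}/enum_mem -enumT.
  apply: sorted_filter; first by move=> a b c; apply: ltn_trans.
  by rewrite -sorted_map val_enum_ord iota_ltn_sorted.
congr cl_basis; apply/setP => k; rewrite inE mem_enum //.
Qed.

Lemma cl_expand u : u = \sum_A u A *: cl_basis A.
Proof.
apply/ffunP => C; rewrite sum_ffunE (bigD1 C) //= big1 ?addr0.
  by rewrite !ffunE eqxx /GRing.scale /= mulr1.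
by move=> A /negbTE neAC; rewrite !ffunE neAC /GRing.scale /= mulr0.
Qed.

End Clifford.

Section Operators.
Variables (R : realType) (n : nat).
Local Notation poly := {mpoly R[n]}.

(* R[x] tensor Cl_(0,n): the Clifford algebra with coordinates in R[x], in which
   p tensor e_A is p *: cl_basis A. *)
Definition cliffpoly : Type := clifford n poly.

HB.instance Definition _ := GRing.Algebra.on cliffpoly.

Implicit Types (O X : 'I_n -> {linear poly -> poly}) (f : cliffpoly).

Definition translate (y : 'rV[R]_n) (p : poly) : poly :=
  p \mPo [tuple 'X_i + (y ord0 i)%:MP | i < n].

Definition shift_invariant (T : poly -> poly) : Prop :=
  forall (y : 'rV[R]_n) (p : poly), T (translate y p) = translate y (T p).

Definition delta_operator O : Prop :=
  (forall j, shift_invariant (O j)) /\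
  exists2 c : R, c != 0 & forall j k, O j 'X_k = (c *+ (j == k))%:MP.

Definition bracket (V : zmodType) (a b : V -> V) : V -> V :=
  fun v => a (b v) - b (a v).

Definition weyl_heisenberg O X : Prop :=
  [/\ forall j k p, bracket (O j) (O k) p = 0,
      forall j k p, bracket (X j) (X k) p = 0
    & forall j k p, bracket (O j) (X k) p = p *+ (j == k)].

(* T tensor id *)
Definition lift_op (T : poly -> poly) f : cliffpoly :=
  [ffun A => T (f A)].

Definition Dop O f : cliffpoly := \sum_j cl_gen _ j * lift_op (O j) f.

Definition xop X f : cliffpoly := \sum_j cl_gen _ j * lift_op (X j) f.

Definition Eop O X f : cliffpoly := \sum_j lift_op (X j) (lift_op (O j) f).

(* A real scalar c acts on R[x] tensor Cl_(0,n) through the constant polynomial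
   c%:MP. *)
Definition Uop O X (s : nat) f : cliffpoly :=
  let k := s./2 in
  if odd s then Eop O X f + (n%:R / 2 + k%:R)%:MP *: f
  else k%:R *: f.

Definition cl_eval f (x : 'rV[R]_n) : clifford n R :=
  [ffun A => (f A : poly).@[fun i => x ord0 i]].

Local Open Scope classical_set_scope.

Definition domain (Omega : set 'rV[R]_n) : Prop :=
  [/\ open Omega, connected Omega & Omega !=set0].

Definition starlike0 (Omega : set 'rV[R]_n) : Prop :=
  forall (x : 'rV[R]_n) (t : R), Omega x -> 0 <= t <= 1 -> Omega (t *: x).

End Operators.

(* Main.v *)
Require Import Defs.
From HB Require Import structures.
From mathcomp Require Import all_boot all_order all_algebra.
From mathcomp Require Import classical_sets reals topology.
From mathcomp Require Import mpoly.

Import Order.TTheory GRing.Theory Num.Theory.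
Import numFieldTopology.Exports.

Local Open Scope ring_scope.

(** The identity holds between elements of R[x] tensor Cl_(0,n), before any
    evaluation at a point.  It rests on two commutation rules: D' and x' satisfy
    D' x' + x' D' = - 2 E' - n = - 2 U_1' ([Dop_xop]), because e_j e_k and
    e_k e_j cancel off the diagonal while the commutators [O_j, x_j'] = id
    contribute e_1 ^ 2 + ... + e_n ^ 2 = - n; and E' x' = x' E' + x'
    ([Eop_xop]), as x' has degree one for the Euler operator.

    The second rule gives x' U_(s+1)' = U_s' x' + (-1)^s x' U_1' ([xop_Uop]).
    The theorem follows by induction on s: apply the case s to x' f in place of
    f, and move D' past the innermost x' with the first rule; the two U' terms
    so obtained add up to x'^s U_(s+1)'. *)

Section VectorOperators.
Context {R : realType} {n : nat}.
Local Notation poly := {mpoly R[n]}.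
Implicit Types (S T : {linear poly -> poly}) (f : cliffpoly R n).
Implicit Types (O X : 'I_n -> {linear poly -> poly}).

Lemma cl_gen_sqr (j : 'I_n) : cl_gen poly j * cl_gen poly j = -1.
Proof.
rewrite /cl_gen cl_basisM symdiffAA /cl_sign.
rewrite (_ : [set _ | _] = [set (j, j)]) ?cards1 ?expr1 ?scaleN1r //.
apply/setP => -[a b]; rewrite !inE xpair_eqE /=.
by case: eqP => //= ->; case: eqP => //= ->; rewrite leqnn.
Qed.

Fact lift_op_is_zmod_morphism T : zmod_morphism (lift_op (n := n) T).
Proof. by move=> f g; apply/ffunP => A; rewrite !ffunE raddfB. Qed.

HB.instance Definition _ T := GRing.isZmodMorphism.Build
  (cliffpoly R n) (cliffpoly R n) (lift_op T) (lift_op_is_zmod_morphism T).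

Lemma lift_opZ T (c : R) f : lift_op T (c%:MP *: f) = c%:MP *: lift_op T f.
Proof.
apply/ffunP => A; rewrite !ffunE /GRing.scale /= !mul_mpolyC.
exact: linearZ_LR.
Qed.

(** Left multiplication by e_j permutes the coordinates up to sign, so it
    commutes with any additive operator applied coordinatewise. *)
Lemma lift_op_gen T (j : 'I_n) f :
  lift_op T (cl_gen poly j * f) = cl_gen poly j * lift_op T f.
Proof.
apply/ffunP => C; rewrite !ffunE raddf_sum; apply: eq_bigr => A _.
rewrite !ffunE /cl_sign.
case: (_ == A); last by rewrite !mul0r !mulr0 raddf0.
by rewrite !mul1r raddfMsign.
Qed.

Fact xop_is_zmod_morphism X : zmod_morphism (xop X).
Proof.
move=> f g; rewrite /xop -sumrB; apply: eq_bigr => j _.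
by rewrite raddfB mulrBr.
Qed.

HB.instance Definition _ X := GRing.isZmodMorphism.Build
  (cliffpoly R n) (cliffpoly R n) (xop X) (xop_is_zmod_morphism X).

Lemma xopZ X (c : R) f : xop X (c%:MP *: f) = c%:MP *: xop X f.
Proof.
by rewrite /xop scaler_sumr; apply: eq_bigr => j _; rewrite lift_opZ scalerAr.
Qed.

Fact iter_xop_is_zmod_morphism X s : zmod_morphism (iter s (xop X)).
Proof. by elim: s => // s IHs f g; rewrite !iterS IHs raddfB. Qed.

HB.instance Definition _ X s := GRing.isZmodMorphism.Build
  (cliffpoly R n) (cliffpoly R n) (iter s (xop X))
  (iter_xop_is_zmod_morphism X s).

Section WeylHeisenberg.
Variables O X : 'I_n -> {linear poly -> poly}.
Hypothesis hOX : weyl_heisenberg O X.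

Lemma lift_op_OX j k f :
  lift_op (O j) (lift_op (X k) f) =
  lift_op (X k) (lift_op (O j) f) + f *+ (j == k).
Proof.
have [_ _ OXp] := hOX.
apply/ffunP => A; rewrite !ffunE.
have /eqP := OXp j k (f A); rewrite /bracket subr_eq addrC => /eqP ->.
by congr (_ + _); case: (j == k); rewrite ?mulr0n ?ffunE.
Qed.

Lemma lift_op_XX j k f :
  lift_op (X j) (lift_op (X k) f) = lift_op (X k) (lift_op (X j) f).
Proof.
have [_ XXp _] := hOX.
apply/ffunP => A; rewrite !ffunE; apply/eqP; rewrite -subr_eq0.
exact/eqP/XXp.
Qed.

(** The anticommutator of D' and x'; the e_j e_k with j != k cancel because the
    operators O_j and x_k' then commute. *)
Lemma Dop_xop f : Dop O (xop X f) = - (2 *: Uop O X 1 f) - xop X (Dop O f).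
Proof.
apply/eqP; rewrite -subr_eq opprK; apply/eqP.
have -> : - (2 *: Uop O X 1 f) = - (Eop O X f *+ 2) - f *+ n.
  rewrite /Uop /= addr0 scalerDr scalerA opprD scaler_nat; congr (_ - _).
  rewrite -[2 : poly](rmorph_nat (@mpolyC n R)) -rmorphM /=.
  by rewrite mulrC divfK ?pnatr_eq0 // rmorph_nat scaler_nat.
have -> : Dop O (xop X f) = \sum_j \sum_k (cl_gen poly j * cl_gen poly k
    * lift_op (X k) (lift_op (O j) f) - f *+ (j == k)).
  rewrite /Dop /xop; apply: eq_bigr => j _; rewrite raddf_sum mulr_sumr.
  apply: eq_bigr => k _; rewrite /= lift_op_gen mulrA lift_op_OX mulrDr.
  congr (_ + _); case: eqP => [<-|_]; last by rewrite mulr0 oppr0.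
  by rewrite mulr1n cl_gen_sqr mulN1r.
have -> : xop X (Dop O f) = \sum_j \sum_k (cl_gen poly k * cl_gen poly j
    * lift_op (X k) (lift_op (O j) f)).
  rewrite /Dop /xop exchange_big; apply: eq_bigr => k _.
  rewrite raddf_sum mulr_sumr; apply: eq_bigr => j _ /=.
  by rewrite lift_op_gen mulrA.
rewrite -big_split /= /Eop -sumrMnl -sumrN.
have -> : f *+ n = \sum_(j < n) f by rewrite sumr_const card_ord.
rewrite -sumrB; apply: eq_bigr => j _.
rewrite -big_split /= (bigD1 j) //= big1 => [|k neq_kj].
  by rewrite eqxx addr0 mulr1n cl_gen_sqr mulN1r addrAC -opprD -mulr2n.
rewrite eq_sym (negbTE neq_kj) subr0 -mulrDl cl_genM eq_sym (negbTE neq_kj).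
by rewrite mulr0 oppr0 mul0r.
Qed.

Lemma Eop_xop f : Eop O X (xop X f) = xop X (Eop O X f) + xop X f.
Proof.
have -> : Eop O X (xop X f) = \sum_j \sum_k (cl_gen poly k
    * lift_op (X k) (lift_op (X j) (lift_op (O j) f))
    + (cl_gen poly k * lift_op (X k) f) *+ (j == k)).
  rewrite /Eop /xop; apply: eq_bigr => j _; rewrite !raddf_sum.
  apply: eq_bigr => k _; rewrite /= !lift_op_gen lift_op_OX raddfD mulrDr.
  rewrite lift_op_XX; congr (_ + _).
  by case: eqP => [->|_]; rewrite ?mulr1n // !mulr0n raddf0 mulr0.
rewrite exchange_big /xop -big_split; apply: eq_bigr => k _ /=.
rewrite big_split /= /Eop raddf_sum mulr_sumr; congr (_ + _).
rewrite (bigD1 k) //= eqxx mulr1n big1 ?addr0 // => j /negbTE ->.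
exact: mulr0n.
Qed.

Lemma Uop_even k f : Uop O X k.*2 f = k%:R *: f.
Proof. by rewrite /Uop odd_double doubleK. Qed.

Lemma Uop_odd k f : Uop O X k.*2.+1 f = Uop O X 1 f + k%:R *: f.
Proof.
rewrite /Uop /= odd_double /= uphalf_double addr0.
by rewrite -addrA -scalerDl rmorphD /= rmorph_nat.
Qed.

(** Between an even index and the next odd one this is the definition of U';
    between an odd index and the next even one it is the commutator
    [E', x'] = x'. *)
Lemma xop_Uop s f :
  xop X (Uop O X s.+1 f) =
  Uop O X s (xop X f) + (-1) ^+ s *: xop X (Uop O X 1 f).
Proof.
have xopn k g : xop X (k%:R *: g) = k%:R *: xop X g.
  by rewrite !scaler_nat raddfMn.
have U1x : Uop O X 1 (xop X f) = xop X (Uop O X 1 f) + xop X f.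
  by rewrite /Uop /= addr0 Eop_xop raddfD /= xopZ addrAC.
rewrite -signr_odd -[s]odd_double_half; set k := s./2; case: (odd s).
  rewrite add1n -doubleS oddS !odd_double Uop_even Uop_odd U1x xopn.
  rewrite expr1 scaleN1r addrAC [_ + xop X f]addrC addrK.
  by rewrite mulrS scalerDl scale1r.
rewrite add0n Uop_odd Uop_even odd_double expr0 scale1r -xopn [RHS]addrC.
exact: (raddfD (xop X)).
Qed.

Lemma Dop_iter_xop s f :
  Dop O (iter s.+1 (xop X) f) =
  - (2 *: iter s (xop X) (Uop O X s.+1 f))
  + (-1) ^+ s.+1 *: iter s.+1 (xop X) (Dop O f).
Proof.
have iter_sign t m g :
    iter t (xop X) ((-1) ^+ m *: g) = (-1) ^+ m *: iter t (xop X) g.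
  rewrite -signr_odd; case: (odd m); last by rewrite expr0 !scale1r.
  by rewrite expr1 !scaleN1r raddfN.
elim: s f => [|s IHs] f; first by rewrite /= expr1 scaleN1r Dop_xop.
have iterD t g h :
    iter t (xop X) (g + h) = iter t (xop X) g + iter t (xop X) h.
  exact: (raddfD (iter t (xop X))).
have iterN t g : iter t (xop X) (- g) = - iter t (xop X) g.
  exact: (raddfN (iter t (xop X))).
have iter2 t g : iter t (xop X) (2 *: g) = 2 *: iter t (xop X) g.
  by rewrite !scaler_nat; exact: (raddfMn (iter t (xop X))).
rewrite [iter s.+2 _ f]iterSr IHs Dop_xop iterD !iterN iter2 -iterSr.
rewrite [in RHS]iterSr xop_Uop iterD iter_sign -iterSr.
move: (iter s _ _) (iter s.+1 _ _) (iter s.+2 _ _) => a b c.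
rewrite scalerBr scalerN scalerDr opprD addrA [_ ^+ s.+2]exprS mulN1r scaleNr.
by rewrite !scalerA mulrC.
Qed.

End WeylHeisenberg.
End VectorOperators.

Theorem lemma3p1 (R : realType) (n : nat) (hn : (1 <= n)%N)
    (O X : 'I_n -> {linear {mpoly R[n]} -> {mpoly R[n]}})
    (hO : delta_operator O) (hOX : weyl_heisenberg O X)
    (Omega : set 'rV[R]_n) (hdom : domain Omega) (hstar : starlike0 Omega)
    (f : cliffpoly R n) (s : nat) (hs : (1 <= s)%N)
    (x : 'rV[R]_n) (hx : Omega x) :
  cl_eval (Dop O (iter s (xop X) f)) x =
  cl_eval (- (2 *: iter s.-1 (xop X) (Uop O X s f))
           + (-1) ^+ s *: iter s (xop X) (Dop O f)) x.
Proof. by case: s hs => // s _; rewrite (Dop_iter_xop O X hOX). Qed.
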